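(* For $n\ge 1$ let $t_n$ be the arbor of size $n$ consisting of a root vertex with one element and $n-1$ child vertices, each a leaf with one element, and let $L_{t_n}(E,V)$ be the bivariate polynomial encoding the Laplace transform of the volume function of $Q_{t_n}$, with $E$ standing for $e^{-v}$ and $V$ standing for $1/v$. Then, as formal power series in $s$, $$\sum_{n\ge1}L_{t_n}(E,V)\,s^n=V\left(\frac{s}{EVs-Vs+1}+\frac{Es}{Es-1}\right).$$
   Context: An arbor $t$ of size $n$ is a rooted tree in which each vertex $v$ is decorated by a non-empty subset of $[n]=\{1,\dots,n\}$, these subsets forming a partition of $[n]$. For a vertex $v$, $\mathcal{D}(v)\subseteq[n]$ is the set of all labels occurring in the sub-tree rooted at $v$ (that is, at $v$ and its descendants). The polytope $Q_t\subset\mathbb{R}^n$ is defined by $x_i\ge 0$ for all $i\in[n]$ and $\sum_{i\in\mathcal{D}(v)}x_i\le|\mathcal{D}(v)|$ for every vertex $v$. The height of a point is $\mathrm{ht}(x)=\sum_i x_i$. For the arbor $t_n$ (labelling the root by $\{n\}$ and the leaves by $\{1\},\dots,\{n-1\}$; $t_1$ is a single vertex), the defining inequalities are $x_i\ge0$ for $1\le i\le n$, $x_i\le 1$ for $1\le i\le n-1$, and $x_1+\cdots+x_n\le n$. The volume function $V_t(h)$ records the volume of the slices of $Q_t$ at height $h$, normalized so that $\int_a^b V_t(h)\,dh$ is the $n$-dimensional Lebesgue volume of $\{x\in Q_t: a\le\mathrm{ht}(x)\le b\}$; it vanishes outside $[0,n]$. (For the arbor of size $1$, $V_t(h)=1$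 for $0\le h\le1$ and $0$ otherwise.) Its Laplace transform is $L_t(v)=\int_0^\infty e^{-vh}V_t(h)\,dh$, so that $L_t(v)=\int_{Q_t}e^{-v\,\mathrm{ht}(x)}\,dx$ and $L_t(0)$ is the volume of $Q_t$. The polynomial $L_t(E,V)\in\mathbb{Q}[E,V]$ is the unique polynomial in two variables that gives $L_t(v)$ for all real $v>0$ when $E$ is replaced by $e^{-v}$ and $V$ by $1/v$. For example, for the arbor of size $1$, $L_t(E,V)=V-VE$. *)

(* Defs.v *)
From HB Require Import structures.
From mathcomp Require Import all_boot all_order all_algebra.

Set Implicit Arguments.
Unset Strict Implicit.
Unset Printing Implicit Defensive.

Import Order.TTheory GRing.Theory Num.Theory.

(* A vertex carries its label and the sub-trees rooted at its children.  The
   children are listed in some order, on which nothing below depends. *)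
Inductive ltree (n : nat) : Type :=
  Vertex of {set 'I_n} & seq (ltree n).

Fixpoint vertex_labels n (t : ltree n) : seq {set 'I_n} :=
  let: Vertex A ts := t in A :: flatten [seq vertex_labels u | u <- ts].

(* The labels occurring in t, that is D(root of t). *)
Definition tree_labels n (t : ltree n) : {set 'I_n} :=
  (\bigcup_(A <- vertex_labels t) A)%SET.

(* The sets D(v), for v running over the vertices of t. *)
Fixpoint descendant_labels n (t : ltree n) : seq {set 'I_n} :=
  let: Vertex _ ts := t in
  tree_labels t :: flatten [seq descendant_labels u | u <- ts].

(* The set {1, ..., n} is rendered as 'I_n = {0, ..., n-1}.  As the labels are
   non-empty, uniq says that distinct vertices have distinct labels, hence
   disjoint ones. *)
Definition is_arbor n (t : ltree n) : bool :=
  uniq (vertex_labels t) &&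
  partition [set A in vertex_labels t] [set: 'I_n].

Record arbor (n : nat) := Arbor {
  arbor_tree :> ltree n;
  arborP : is_arbor arbor_tree }.

(* The arbor t_(m+1): its root is labelled by the last element. *)
Definition star_tree (m : nat) : ltree m.+1 :=
  Vertex [set ord_max]
    [seq Vertex [set widen_ord (leqnSn m) i] [::] | i <- enum 'I_m].

Lemma star_tree_labels m : vertex_labels (star_tree m) =
  [set ord_max] :: [seq [set widen_ord (leqnSn m) i] | i <- enum 'I_m].
Proof.
by rewrite /= -map_comp; congr cons; elim: (enum _) => //= i s ->.
Qed.

Lemma widen_ord_neq_max m (i : 'I_m) : widen_ord (leqnSn m) i != ord_max.
Proof. by rewrite -val_eqE /= neq_ltn ltn_ord. Qed.

Lemma star_tree_arbor m : is_arbor (star_tree m).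
Proof.
rewrite /is_arbor star_tree_labels /=; apply/andP; split.
  apply/andP; split.
    apply/mapP => -[i _ /eqP]; rewrite eqEsubset sub1set inE => /andP[/eqP e _].
    by have := widen_ord_neq_max i; rewrite -e eqxx.
  rewrite map_inj_uniq ?enum_uniq // => i j /set1_inj /(congr1 val) /= ij.
  exact: val_inj.
have E A : (A \in [set A0 in [set ord_max] ::
    [seq [set widen_ord (leqnSn m) i] | i <- enum 'I_m]]) =
    (A \in [set [set x] | x in [set: 'I_m.+1]]).
  rewrite !inE; apply/idP/imsetP.
    by case/orP => [/eqP ->|/mapP[i _ ->]]; eexists => //; rewrite inE.
  case=> x _ ->; case: (unliftP ord_max x) => [j ->|->]; last by rewrite eqxx.
  apply/orP; right; apply/mapP; exists j; first by rewrite mem_enum.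
  by congr set1; apply: val_inj; exact: lift_max.
rewrite (_ : [set A in _ :: _] = [set [set x] | x in [set: 'I_m.+1]]);
  last exact/setP.
apply/and3P; split.
- apply/eqP/setP => x; rewrite inE; apply/bigcupP; exists [set x].
    by apply/imsetP; exists x.
  by rewrite inE.
- apply/trivIsetP => _ _ /imsetP[x _ ->] /imsetP[y _ ->] xy.
  by rewrite disjoints1 inE; apply: contraNN xy => /eqP ->.
- by apply/imsetP => -[x _ /setP /(_ x)]; rewrite !inE eqxx.
Qed.

Definition star_arbor (m : nat) : arbor m.+1 := Arbor (star_tree_arbor m).

Lemma mem_tree_labels n (t : arbor n) i : i \in tree_labels t.
Proof.
case: t => t /= /andP[_ /and3P[/eqP tc _ _]].
have : i \in [set: 'I_n] by rewrite inE.
rewrite -tc => /bigcupP[A]; rewrite inE /tree_labels => At iA.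
by rewrite (big_rem A) //= inE iA.
Qed.

From mathcomp Require Import all_classical all_reals all_analysis.
Import numFieldNormedType.Exports.

Local Open Scope classical_set_scope.
Local Open Scope ring_scope.

Section power_series.
Variable A : comUnitRingType.

(* A record rather than nat -> A, whose library ring structure is pointwise. *)
Record fps : Type := Fps { fps_coef : nat -> A }.

Implicit Types f g h : fps.

Lemma fpsP f g : (forall n, fps_coef f n = fps_coef g n) -> f = g.
Proof. by case: f g => f [g] /= fg; congr Fps; apply/funext. Qed.

HB.instance Definition _ := gen_eqMixin fps.
HB.instance Definition _ := gen_choiceMixin fps.

Definition fpsC (a : A) : fps := Fps (fun n => if n is 0%N then a else 0).
Definition fpsX : fps := Fps (fun n => (n == 1%N)%:R).

Definition fps_add f g : fps := Fps (fun n => fps_coef f n + fps_coef g n).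
Definition fps_opp f : fps := Fps (fun n => - fps_coef f n).
Definition fps_mul f g : fps :=
  Fps (fun n => \sum_(i < n.+1) fps_coef f i * fps_coef g (n - i)%N).

Lemma fps_addA : associative fps_add.
Proof. by move=> f g h; apply: fpsP => n /=; rewrite addrA. Qed.
Lemma fps_addC : commutative fps_add.
Proof. by move=> f g; apply: fpsP => n /=; rewrite addrC. Qed.
Lemma fps_add0 : left_id (fpsC 0) fps_add.
Proof. by move=> f; apply: fpsP => -[|n] /=; rewrite add0r. Qed.
Lemma fps_addN : left_inverse (fpsC 0) fps_opp fps_add.
Proof. by move=> f; apply: fpsP => -[|n] /=; rewrite addNr. Qed.

HB.instance Definition _ :=
  GRing.isZmodule.Build fps fps_addA fps_addC fps_add0 fps_addN.

Let trunc n f : {poly A} := \poly_(i < n.+1) fps_coef f i.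

Let fps_mul_trunc f g n m : (n <= m)%N ->
  fps_coef (fps_mul f g) n = (trunc m f * trunc m g)`_n.
Proof.
move=> nm; rewrite coefM; apply: eq_bigr => i _; rewrite !coef_poly.
by rewrite !ltnS (leq_trans (leq_subr _ _) nm) (leq_trans _ nm) // -ltnS.
Qed.

Lemma fps_mulC : commutative fps_mul.
Proof. by move=> f g; apply: fpsP => n; rewrite !(@fps_mul_trunc _ _ n n) // mulrC. Qed.

Lemma fps_mulA : associative fps_mul.
Proof.
move=> f g h; apply: fpsP => n.
have L (p : {poly A}) f' : (forall i, (i <= n)%N -> p`_i = fps_coef f' i) ->
    forall f'', fps_coef (fps_mul f'' f') n = (trunc n f'' * p)`_n.
  move=> pf f''; rewrite coefM; apply: eq_bigr => i _; rewrite coef_poly ltn_ord.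
  by rewrite pf // leq_subr.
rewrite (L (trunc n g * trunc n h) (fps_mul g h)); last by move=> i ?; rewrite (@fps_mul_trunc _ _ i n).
rewrite [fps_mul _ h]fps_mulC (L (trunc n f * trunc n g) (fps_mul f g)); last first.
  by move=> i ?; rewrite (@fps_mul_trunc _ _ i n).
by rewrite [in RHS]mulrC mulrA.
Qed.

Lemma fps_mul1 : left_id (fpsC 1) fps_mul.
Proof.
move=> f; apply: fpsP => n /=; rewrite big_ord_recl /= mul1r subn0.
by rewrite big1 ?addr0 // => i _; rewrite mul0r.
Qed.

Lemma fps_mulDl : left_distributive fps_mul fps_add.
Proof.
move=> f g h; apply: fpsP => n /=; rewrite -big_split /=.
by apply: eq_bigr => i _; rewrite mulrDl.
Qed.

Lemma fps_oner_neq0 : fpsC 1 != 0 :> fps.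
Proof.
apply/eqP => /(congr1 (fps_coef ^~ 0%N)) /= /eqP; by rewrite oner_eq0.
Qed.

HB.instance Definition _ := GRing.Zmodule_isComNzRing.Build fps
  fps_mulA fps_mulC fps_mul1 fps_mulDl fps_oner_neq0.

(* The first n+1 coefficients of the inverse of f. *)
Fixpoint fps_inv_seq f n : seq A :=
  if n is m.+1 then
    let s := fps_inv_seq f m in
    rcons s (- (fps_coef f 0)^-1 * \sum_(i < m.+1) s`_i * fps_coef f (m.+1 - i)%N)
  else [:: (fps_coef f 0)^-1].

Definition fps_unit : pred fps := fun f => fps_coef f 0 \is a GRing.unit.

(* As in the library, a non-unit is sent to itself. *)
Definition fps_inv f : fps :=
  if fps_unit f then Fps (fun n => (fps_inv_seq f n)`_n) else f.

Let size_inv f n : size (fps_inv_seq f n) = n.+1.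
Proof. by elim: n => //= n IH; rewrite size_rcons IH. Qed.

Let nth_inv f n m : (n <= m)%N -> (fps_inv_seq f m)`_n = (fps_inv_seq f n)`_n.
Proof.
elim: m => [|m IH]; first by rewrite leqn0 => /eqP ->.
rewrite leq_eqVlt => /orP[/eqP -> //|nm].
by rewrite /= nth_rcons size_inv nm IH.
Qed.

Lemma fps_mulV : {in fps_unit, left_inverse 1 fps_inv *%R}.
Proof.
move=> f fu; rewrite /fps_inv (_ : fps_unit f) //; rewrite unfold_in in fu; apply: fpsP => -[|n] /=.
  by rewrite big_ord1 /= mulVr.
rewrite big_ord_recr /= subnn nth_rcons size_inv ltnn eqxx.
rewrite [X in _ + X]mulrAC mulNr mulVr // mulN1r.
apply/eqP; rewrite subr_eq0; apply/eqP; apply: eq_bigr => i _.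
by rewrite (@nth_inv f i n) // -ltnS.
Qed.

Lemma fps_unitP f g : g * f = 1 -> fps_unit f.
Proof.
move=> /(congr1 (fps_coef ^~ 0%N)) /=; rewrite big_ord1 /= => gf.
by apply/unitrP; exists (fps_coef g 0); split=> //; rewrite mulrC.
Qed.

Lemma fps_inv_out : {in [predC fps_unit], fps_inv =1 id}.
Proof.
by move=> f; rewrite inE => /negbTE fu; rewrite /fps_inv [fps_unit f]fu.
Qed.

HB.instance Definition _ := GRing.ComNzRing_hasMulInverse.Build fps
  fps_mulV fps_unitP fps_inv_out.

End power_series.

Section tuple_lebesgue.
Context (R : realType).
Local Notation RT := (measurableTypeR R).

Definition tuple_cons n (p : RT * n.-tuple RT) : n.+1.-tuple RT :=
  [tuple of p.1 :: p.2].

Lemma measurable_tuple_cons n : measurable_fun [set: _] (@tuple_cons n).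
Proof. exact: measurable_cons. Qed.

Lemma tuple_consE n (x : n.+1.-tuple RT) :
  x = tuple_cons (thead x, [tuple of behead x]).
Proof. exact: tuple_eta. Qed.

Section step.
Variables (n : nat) (mu : {sigma_finite_measure set (n.-tuple RT) -> \bar R}).

Definition lebesgue_cons : set (n.+1.-tuple RT) -> \bar R :=
  pushforward (lebesgue_measure \x mu)%E (@tuple_cons n).

Let lebesgue_cons0 : lebesgue_cons set0 = 0%E.
Proof. by rewrite /lebesgue_cons /pushforward preimage_set0 measure0. Qed.

Let lebesgue_cons_ge0 A : (0 <= lebesgue_cons A)%E.
Proof. exact: (measure_ge0 (lebesgue_measure \x mu)%E). Qed.

Let lebesgue_cons_sigma_additive : semi_sigma_additive lebesgue_cons.
Proof.
move=> F mF tF mUF; rewrite /lebesgue_cons /pushforward preimage_bigcup.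
apply: measure_semi_sigma_additive.
- by move=> k; rewrite -[X in measurable X]setTI; exact: measurable_tuple_cons.
- apply/trivIsetP => /= i j _ _ ij; rewrite -preimage_setI.
  by move/trivIsetP : tF => /(_ _ _ _ _ ij) -> //; rewrite preimage_set0.
- rewrite -preimage_bigcup -[X in measurable X]setTI.
  exact: measurable_tuple_cons.
Qed.

HB.instance Definition _ := isMeasure.Build _ _ _ lebesgue_cons
  lebesgue_cons0 lebesgue_cons_ge0 lebesgue_cons_sigma_additive.

Let lebesgue_cons_sigma_finite : sigma_finite setT lebesgue_cons.
Proof.
have /sigma_finiteP[F [FT ndF Foo]] := sigma_finiteT (@lebesgue_measure R).
have /sigma_finiteP[G [GT ndG Goo]] := sigma_finiteT mu.
exists (fun k => [set x | F k (thead x) /\ G k [tuple of behead x]]).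
  apply/seteqP; split=> // x _.
  have [i _ Fi] : (\bigcup_i F i) (thead x) by rewrite -FT.
  have [j _ Gj] : (\bigcup_i G i) [tuple of behead x] by rewrite -GT.
  exists (maxn i j) => //=; split.
    by move: Fi; exact/subsetPset/ndF/leq_maxl.
  by move: Gj; exact/subsetPset/ndG/leq_maxr.
move=> k; have [mF Fk] := Foo k; have [mG Gk] := Goo k; split.
  apply: measurableI.
    by rewrite -[X in measurable X]setTI; exact: measurable_tnth.
  by rewrite -[X in measurable X]setTI; exact: measurable_behead.
rewrite /lebesgue_cons /pushforward (_ : _ @^-1` _ = F k `*` G k).
  by rewrite product_measure1E // lte_mul_pinfty // ge0_fin_numE.
by apply/seteqP; split=> -[x y] /=; rewrite theadE;
  rewrite (_ : [tuple of _] = y) //; apply: val_inj.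
Qed.

HB.instance Definition _ := Measure_isSigmaFinite.Build _ _ _ lebesgue_cons
  lebesgue_cons_sigma_finite.

End step.

(* The n-dimensional Lebesgue measure, as an n-fold product; R^0 is a point of
   measure 1. *)
Fixpoint lebesgue_tuple n : {sigma_finite_measure set (n.-tuple RT) -> \bar R} :=
  if n is m.+1 then lebesgue_cons (lebesgue_tuple m) else \d_[tuple].

End tuple_lebesgue.

Section volume_function.
Context (R : realType).
Local Notation RT := (measurableTypeR R).

Definition height n (x : n.-tuple RT) : R := \sum_(i < n) tnth x i.

Definition polytope n (t : arbor n) : set (n.-tuple RT) :=
  [set x | (forall i, 0 <= tnth x i) /\
    (forall A, A \in descendant_labels t -> \sum_(i in A) tnth x i <= #|A|%:R)].

(* The slice of Q_t at height h is parametrised by all the coordinates of its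
   points but the first one, which is then h - height y.  The map
   x |-> (height x, remaining coordinates) has determinant 1, whence the
   normalisation stated in volume_functionP.  (No arbor has size 0.) *)
Definition volume_function n (t : arbor n.+1) (h : R) : \bar R :=
  lebesgue_tuple R n [set y | polytope t (tuple_cons (h - height y, y))].

Definition laplace n (t : arbor n.+1) (v : R) : \bar R :=
  (\int[lebesgue_measure]_(h in `[0%R, +oo[)
     ((expR (- (v * h)))%:E * volume_function t h))%E.

Lemma height_cons n (p : RT * n.-tuple RT) :
  height (tuple_cons p) = p.1 + height p.2.
Proof.
rewrite /height big_ord_recl /=; congr (_ + _).
by apply: eq_bigr => i _; rewrite tnthS.
Qed.

Lemma measurable_sum_tnth n (P : pred 'I_n) :
  measurable_fun [set: n.-tuple RT] (fun x => \sum_(i | P i) tnth x i : R).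
Proof.
under eq_fun do rewrite big_mkcond.
apply: measurable_sum => i; case: (P i) => //.
exact: measurable_tnth.
Qed.

Lemma measurable_polytope n (t : arbor n) : measurable (polytope t).
Proof.
rewrite (_ : polytope t =
    \bigcap_(i in [set: 'I_n])
      ((fun x : n.-tuple RT => tnth x i) @^-1` `[0, +oo[) `&`
    \bigcap_(A in [set` descendant_labels t])
      ((fun x : n.-tuple RT => \sum_(i in A) tnth x i) @^-1` `]-oo, #|A|%:R])).
  apply: measurableI.
    apply: fin_bigcap_measurable => [|i _]; first exact: finite_finset.
    rewrite -[X in measurable X]setTI; apply: measurable_tnth => //.
  apply: fin_bigcap_measurable => [|A _]; first exact: finite_seq.
  rewrite -[X in measurable X]setTI; apply: measurable_sum_tnth => //.
apply/seteqP; split=> x /= [x0 xA]; split=> [i|A tA]; try move=> _.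
- by rewrite /= in_itv /= x0.
- by rewrite /= in_itv /= xA.
- by have := x0 i I; rewrite /= in_itv /= andbT.
- by have := xA A tA; rewrite /= in_itv.
Qed.

Lemma lebesgue_measureD (c : R) (A : set RT) : measurable A ->
  lebesgue_measure ((fun x : RT => x + c : RT) @^-1` A) = lebesgue_measure A.
Proof.
have mD : measurable_fun [set: RT] (fun x : RT => x + c : RT).
  by apply: measurable_realfun.measurable_funD => //; exact: measurable_id.
move=> mA; rewrite -/(pushforward lebesgue_measure (fun x : RT => x + c : RT) A).
apply/esym/lebesgue_measure_unique => //= _ [[a b]] _ <-.
rewrite /pushforward (_ : _ @^-1` _ = `]a - c, b - c]%classic).
  rewrite !lebesgue_measure_itv /= !lte_fin ltrD2r.
  by rewrite -!EFinB opprB addrA subrK.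
by apply/seteqP; split=> x /=; rewrite !in_itv /= ltrBlDr lerBrDr.
Qed.

Lemma fubini_sections n (A : set (RT * n.-tuple RT)) : measurable A ->
  (\int[lebesgue_measure]_h lebesgue_tuple R n (xsection A h) =
   \int[lebesgue_tuple R n]_y lebesgue_measure (ysection A y))%E.
Proof.
move=> mA.
have := @indic_fubini_tonelli _ _ _ _ R (@lebesgue_measure R)
  (lebesgue_tuple R n) A mA.
by rewrite indic_fubini_tonelli_FE // indic_fubini_tonelli_GE.
Qed.

Lemma measurable_height n : measurable_fun [set: n.-tuple RT] (@height n).
Proof. exact: (@measurable_sum_tnth n xpredT). Qed.

Lemma volume_functionP n (t : arbor n.+1) (a b : R) :
  (\int[lebesgue_measure]_(h in `[a, b]) volume_function t h)%E =
  lebesgue_tuple R n.+1 [set x | polytope t x /\ a <= height x <= b].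
Proof.
pose S := [set p : RT * n.-tuple RT |
  polytope t (tuple_cons p) /\ a <= height (tuple_cons p) <= b].
pose sh (p : RT * n.-tuple RT) : RT * n.-tuple RT := (p.1 - height p.2, p.2).
have mh m : measurable [set x : m.-tuple RT | a <= height x <= b].
  rewrite (_ : [set x | _] = @height m @^-1` `[a, b]).
    by rewrite -[X in measurable X]setTI; exact: measurable_height.
  by apply/seteqP; split=> x /=; rewrite in_itv.
have mS : measurable S.
  rewrite (_ : S = @tuple_cons R n @^-1`
      (polytope t `&` [set x | a <= height x <= b])) //.
  rewrite -[X in measurable X]setTI; apply: measurable_tuple_cons => //.
  apply: measurableI; [exact: measurable_polytope | exact: mh].
have msh : measurable_fun [set: _] sh.
  apply: measurable_fun_pair => //=.
  apply: measurable_realfun.measurable_funB => //=.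
  apply: (@measurableT_comp _ _ _ _ _ _ (@height n)) => //.
  exact: measurable_height.
have mshS : measurable (sh @^-1` S).
  by rewrite -[X in measurable X]setTI; exact: msh.
transitivity (\int[lebesgue_measure]_h
    lebesgue_tuple R n (xsection (sh @^-1` S) h))%E.
  rewrite integral_mkcond; apply: eq_integral => h _.
  rewrite patchE; case: ifPn => [|] hab.
    congr (lebesgue_tuple R n _); apply/seteqP; split=> y; rewrite /xsection /=;
      rewrite ?inE /S /= height_cons /= subrK.
      by move=> ?; split=> //; move: hab; rewrite inE /= in_itv.
    by case.
  rewrite (_ : xsection _ _ = set0) ?measure0 //.
  apply/seteqP; split=> y //=; rewrite /xsection /= inE /S /= height_cons /= subrK.
  by case=> _ hab'; move/negP: hab; apply; rewrite inE /= in_itv.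
rewrite fubini_sections //=.
transitivity (\int[lebesgue_tuple R n]_y lebesgue_measure (ysection S y))%E.
  apply: eq_integral => y _.
  rewrite -[RHS](lebesgue_measureD (- height y)); last exact: measurable_ysection.
  by congr lebesgue_measure; apply/seteqP; split=> h; rewrite /ysection /= !inE.
by rewrite -fubini_sections.
Qed.

Lemma volume_function_out n (t : arbor n.+1) (h : R) :
  h \notin `[0, n.+1%:R] -> volume_function t h = 0%E.
Proof.
move=> hn; rewrite /volume_function (_ : [set y | _] = set0) ?measure0 //.
apply/seteqP; split=> y //= -[x0 xt]; move/negP: hn; apply.
have hE : height (tuple_cons (h - height y, y)) = h by rewrite height_cons subrK.
rewrite in_itv /= -hE; apply/andP; split; first by apply: sumr_ge0 => i _.
have tl : tree_labels t \in descendant_labels t.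
  by case: (arbor_tree t) => A ts; rewrite /= inE eqxx.
have lT : tree_labels t = [set: 'I_n.+1]%SET.
  by apply/setP => i; rewrite inE mem_tree_labels.
have := xt _ tl; rewrite lT cardsT card_ord; apply: le_trans.
by rewrite /height big_mkcond /= [leRHS]big_mkcond /= ler_sum // => i _; rewrite inE.
Qed.

Lemma polytope_starP m (x : m.+1.-tuple RT) :
  polytope (star_arbor m) x <->
  [/\ forall i, 0 <= tnth x i, forall i : 'I_m.+1, (i < m)%N -> tnth x i <= 1 &
      height x <= m.+1%:R].
Proof.
have dE : descendant_labels (star_arbor m) =
    [set: 'I_m.+1]%SET :: [seq [set widen_ord (leqnSn m) i]%SET | i <- enum 'I_m].
  rewrite (_ : [set: _]%SET = tree_labels (star_arbor m)); last first.
    by apply/setP => i; rewrite inE mem_tree_labels.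
  rewrite /= -map_comp; congr cons; elim: (enum _) => //= i s ->.
  by rewrite /tree_labels /= big_seq1.
have hE : \sum_(i in [set: 'I_m.+1]%SET) tnth x i = height x.
  by apply: eq_bigl => i; rewrite inE.
split=> [[x0 xA]|[x0 x1 xs]]; split=> //.
- move=> i im; have := xA [set widen_ord (leqnSn m) (Ordinal im)]%SET.
  rewrite dE inE map_f ?mem_enum ?orbT // big_set1 cards1 => /(_ isT).
  by rewrite (_ : widen_ord _ _ = i) //; apply: val_inj.
- by rewrite -hE -[X in X%:R](card_ord m.+1) -cardsT; apply: xA; rewrite dE inE eqxx.
- move=> A; rewrite dE inE => /orP[/eqP ->|/mapP[i _ ->]].
    by rewrite hE cardsT card_ord.
  by rewrite big_set1 cards1; apply: x1 => /=.
Qed.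

End volume_function.

(* Q[E, V] is rendered as {poly {poly rat}}, with E the outer variable. *)
Definition Evar : {poly {poly rat}} := 'X.
Definition Vvar : {poly {poly rat}} := 'Y.

Definition eval_EV (R : realType) (L : {poly {poly rat}}) (e v : R) : R :=
  (map_poly (map_poly ratr) L).[e, v].

Definition is_laplace_poly (R : realType) n (t : arbor n.+1)
    (L : {poly {poly rat}}) : Prop :=
  forall v : R, 0 < v -> laplace t v = (eval_EV L (expR (- v)) v^-1)%:E.

(* The polynomial L such that is_laplace_poly R t L, or 0 if there is none. *)
Definition laplace_poly (R : realType) n (t : arbor n.+1) : {poly {poly rat}} :=
  xget 0 [set L | is_laplace_poly R t L].

(* Main.v *)
From HB Require Import structures.
Require Import Defs.
From mathcomp Require Import all_boot all_order all_algebra.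
From mathcomp Require Import ring lra.
From mathcomp Require Import all_classical all_reals all_analysis.
From mathcomp Require Import measurable_realfun.

Import Order.TTheory GRing.Theory Num.Theory.

Local Open Scope ring_scope.

(* Integrating e^(-v ht(x)) over the coordinate of the root first gives
   V (e^(-v (x_1 + ... + x_(n-1))) - E^n), which is then integrated over the
   unit cube to give L_(t_n) = V ((V (1 - E))^(n-1) - E^n); the generating
   series is a difference of two geometric series.  To identify this
   polynomial as L_(t_n) one needs that a polynomial vanishing at
   (e^(-v), 1/v) for all v > 0 is 0, which follows by letting v tend to
   infinity. *)

(** * Coefficients and geometric series of formal power series *)

Section fps_coefficients.
Context {A : comUnitRingType}.
Implicit Types f g : fps A.

Lemma coef_fpsB f g n : fps_coef (f - g) n = fps_coef f n - fps_coef g n.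
Proof. by []. Qed.

Lemma coef_fpsCM (a : A) f n : fps_coef (fpsC a * f) n = a * fps_coef f n.
Proof.
rewrite /= big_ord_recl /= subn0 big1 ?addr0 // => i _.
by rewrite mul0r.
Qed.

Lemma coef_fpsMX f n :
  fps_coef (f * fpsX A) n = if n is k.+1 then fps_coef f k else 0.
Proof.
case: n => [|n] /=; first by rewrite big_ord1 /= mulr0.
rewrite big_ord_recr big_ord_recr /= subSnn subnn mulr1 mulr0 addr0.
rewrite big1 ?add0r // => i _.
by rewrite subSn ?(ltnW (ltn_ord _)) // eqSS subn_eq0 leqNgt ltn_ord mulr0.
Qed.

Lemma fpsC_is_zmod_morphism : zmod_morphism (@fpsC A).
Proof. by move=> a b; apply: fpsP => -[|n] //=; rewrite subr0. Qed.

Lemma fpsC_is_monoid_morphism : monoid_morphism (@fpsC A).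
Proof.
split=> // a b; apply: fpsP => n.
by rewrite coef_fpsCM; case: n => //= n; rewrite mulr0.
Qed.

HB.instance Definition _ :=
  GRing.isZmodMorphism.Build A (fps A) (@fpsC A) fpsC_is_zmod_morphism.
HB.instance Definition _ :=
  GRing.isMonoidMorphism.Build A (fps A) (@fpsC A) fpsC_is_monoid_morphism.

(** The denominator has constant coefficient 1, so it is a unit and can be cleared; the claimed
    series minus [a * X] times itself then telescopes to [X]. *)
Lemma geometric_fps (a : A) :
  fpsX A / (1 - fpsC a * fpsX A) =
  Fps (fun n => if n is k.+1 then a ^+ k else 0).
Proof.
set D := 1 - _; have uD : D \is a GRing.unit.
  by rewrite unfold_in /= /fps_unit /= big_ord1 /= mulr0 subr0 unitr1.
apply: (mulIr uD); rewrite divrK // /D mulrBr mulr1 mulrCA.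
apply: fpsP => n; rewrite coef_fpsB coef_fpsCM coef_fpsMX.
by case: n => [|[|n]] /=; rewrite ?mulr0 ?subr0 // exprS subrr.
Qed.

End fps_coefficients.

(** * Asymptotics at infinity and uniqueness of the polynomial in E and V *)

Section uniqueness.
Context {R : realType}.
Local Open Scope classical_set_scope.
Import numFieldNormedType.Exports.

Lemma cvgV0_pinfty : v^-1 @[v --> +oo] --> (0 : R).
Proof.
by apply: (proj2 (gtr0_cvgV0 _)) => //; exact: nbhs_pinfty_gt.
Qed.

Lemma expRN_exprn_cvg0 n : expR (- v) * v ^+ n @[v --> +oo] --> (0 : R).
Proof.
(* Upper bound for the squeeze: the Taylor term of degree n+1 gives v^(n+1) / (n+1)! <= e^v, one
   power of v more than needed. *)
have h0 : v^-1 * n.+1`!%:R @[v --> +oo] --> (0 : R).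
  rewrite -[0 in X in _ --> X](mul0r (n.+1`!%:R)).
  by apply: cvgMl; exact: cvgV0_pinfty.
apply: (squeeze_cvgr _ (cvg_cst 0) h0); near=> v.
have v0 : 0 < v by near: v; exact: nbhs_pinfty_gt.
rewrite mulr_ge0 ?expR_ge0 ?exprn_ge0 ?(ltW v0) //=.
rewrite expRN ler_pdivrMl ?expR_gt0 // mulrCA ler_pdivlMl // -exprS.
rewrite -ler_pdivrMr ?ltr0n ?fact_gt0 //.
by apply: le_trans (expR_ge1Dxn n (ltW v0)); rewrite lerDr.
Unshelve. all: end_near. Qed.

Lemma horner2MXaddC (q : {poly {poly R}}) c (e w : R) :
  (q * 'X + c%:P).[e, w] = q.[e, w] * e + c.[w].
Proof. by rewrite !hornerE. Qed.

Lemma horner_inv_cvg (c : {poly R}) : c.[v^-1] @[v --> +oo] --> c.[0].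
Proof.
exact: cvg_comp cvgV0_pinfty (@continuous_horner R c 0).
Qed.

(** The factor e^(-v) is the one carried by every term of positive degree in E; v^n is the scaling
    that will keep the constant term away from 0. In the induction, q gains a further e^(-v), and
    c(1/v) stays bounded. *)
Lemma horner2_expRN_cvg0 (q : {poly {poly R}}) n :
  q.[expR (- v), v^-1] * (expR (- v) * v ^+ n) @[v --> +oo] --> (0 : R).
Proof.
elim/poly_ind: q => [|q c IH].
  under eq_cvg do rewrite !horner0 mul0r; apply: cvg_cst.
have := cvgD (cvgM IH (@cvgr_expR R))
  (cvgM (horner_inv_cvg c) (expRN_exprn_cvg0 n)).
rewrite !mulr0 addr0 => /(_ _ _ _); apply: cvg_trans.
apply: near_eq_cvg; near=> v; rewrite /=.
by rewrite horner2MXaddC mulrDl [X in _ = X + _]mulrAC.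
Unshelve. all: end_near. Qed.

(* In p X + c, the constant coefficient c is a power of Y times a polynomial
   that does not vanish at 0, hence decays polynomially in v when
   evaluated at 1/v, while the remaining terms decay exponentially. *)
Lemma horner2_expRN_neq0 (p : {poly {poly R}}) :
  p != 0 -> \forall v \near +oo, p.[expR (- v), v^-1] != 0.
Proof.
elim/poly_ind: p => [|p c IH]; first by rewrite eqxx.
have [->|c0 _] := eqVneq c 0.
  rewrite polyC0 addr0 mulf_eq0 polyX_eq0 orbF => /IH p0.
  by apply: filterS p0 => v pv; rewrite !hornerE mulf_neq0 // gt_eqF ?expR_gt0.
have [k [d /implyP/(_ c0) d0 cE]] := multiplicity_XsubC c 0.
have cvg_d : v ^+ k * (p * 'X + c%:P).[expR (- v), v^-1] @[v --> +oo] --> d.[0].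
  rewrite -[d.[0]]add0r; have := cvgD (horner2_expRN_cvg0 p k) (horner_inv_cvg d).
  move=> /(_ _); apply: cvg_trans.
  apply: near_eq_cvg; near=> v.
  have v0 : v != 0 by rewrite gt_eqF //; near: v; exact: nbhs_pinfty_gt.
  rewrite /= horner2MXaddC cE fctE !hornerE subr0 exprVn.
  rewrite mulrDr [X in _ = _ + X]mulrCA mulfV ?expf_neq0 // mulr1.
  by rewrite [X in _ = X + _]mulrC.
have : \forall v \near +oo, v ^+ k * (p * 'X + c%:P).[expR (- v), v^-1] != 0.
  exact: cvgr_neq0 cvg_d d0.
by apply: filterS => v; apply: contraNneq => ->; rewrite mulr0.
Unshelve. all: end_near. Qed.

End uniqueness.

(** Rational coefficients embed injectively into [R], and over [R] a nonzero difference would be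
    nonzero at some large v > 0. *)
Lemma eval_EV_inj (R : realType) (L L' : {poly {poly rat}}) :
  (forall v : R, 0 < v ->
    eval_EV L (expR (- v)) v^-1 = eval_EV L' (expR (- v)) v^-1) -> L = L'.
Proof.
have inj : injective (map_poly (map_poly (@ratr R))).
  apply: map_inj_poly; last by rewrite map_poly0.
  by apply: map_inj_poly; [exact: fmorph_inj|exact: rmorph0].
move=> LL'; apply: inj; apply/eqP; rewrite -subr_eq0; apply/negP => /negP.
move/horner2_expRN_neq0 => h.
have [v []] := filter_ex (filterI h (nbhs_pinfty_gt (num_real (0 : R)))).
by rewrite /= !hornerE => /negP + v0; apply; rewrite subr_eq0; apply/eqP/LL'.
Qed.

(** [xget] returns an unspecified witness, so computing it takes uniqueness. *)
Lemma laplace_polyE (R : realType) n (t : arbor n.+1) (L : {poly {poly rat}}) :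
  is_laplace_poly R t L -> laplace_poly R t = L.
Proof.
move=> tL; apply: xget_unique => // L' tL'; apply: (@eval_EV_inj R) => v v0.
by apply: EFin_inj; rewrite -tL // tL'.
Qed.

Lemma series_star (L : nat -> {poly {poly rat}}) :
  (forall m, L m = Vvar * ((Vvar * (1 - Evar)) ^+ m - Evar ^+ m.+1)) ->
  let s : fps {poly {poly rat}} := fpsX _ in
  let E := fpsC Evar in
  let V := fpsC Vvar in
  Fps (fun n => if n is m.+1 then L m else 0) =
  V * (s / (E * V * s - V * s + 1) + E * s / (E * s - 1)).
Proof.
move=> LE s E V.
have -> : E * V * s - V * s + 1 = 1 - fpsC (Vvar * (1 - Evar)) * s.
  by rewrite rmorphM rmorphB rmorph1 -/E -/V; ring.
(* Es/(Es - 1) is -E times the geometric series s/(1 - Es), hence the coefficients -E^(m+1). *)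
rewrite -(opprB 1 (E * s)) invrN mulrN -mulrA !geometric_fps.
apply: fpsP => n; rewrite coef_fpsCM coef_fpsB coef_fpsCM.
by case: n => [|n] /=; rewrite ?mulr0 ?subr0 ?mulr0 // LE exprS.
Qed.

(** * The Laplace transform as an integral over the polytope, and its value for the star *)

Section integrals.
Context {R : realType}.
Local Notation RT := (measurableTypeR R).
Local Notation mu := (@lebesgue_measure R).
Local Open Scope classical_set_scope.
Import numFieldNormedType.Exports.

Lemma integral_lebesgue_tupleS n (f : n.+1.-tuple RT -> \bar R) :
  measurable_fun [set: n.+1.-tuple RT] f -> (forall x, 0 <= f x)%E ->
  (\int[lebesgue_tuple R n.+1]_x f x =
   \int[mu]_x \int[lebesgue_tuple R n]_y f (tuple_cons (x, y)))%E.
Proof.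
move=> mf f0.
rewrite -(@fubini_tonelli1 _ _ _ _ _ _ _ (f \o @tuple_cons R n)).
- exact: (ge0_integral_pushforward (@measurable_tuple_cons R n)).
- by apply: (measurableT_comp mf); exact: measurable_tuple_cons.
- by move=> p; exact: f0.
Qed.

Lemma ge0_integral_shift (c : R) (f : RT -> \bar R) :
  measurable_fun [set: RT] f -> (forall x, 0 <= f x)%E ->
  (\int[mu]_x f (x + c)%R = \int[mu]_x f x)%E.
Proof.
move=> mf f0.
have mD : measurable_fun [set: RT] (fun x : RT => x + c : RT).
  by apply: measurable_funD => //; exact: measurable_id.
rewrite -(ge0_integral_pushforward mD _ measurableT) //.
by apply: eq_measure_integral => A mA _; exact: lebesgue_measureD.
Qed.

(** The one-variable integral met both for the root (a = 1, b = 0) and for each leaf. *)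
Lemma integral_expRN_affine (v a b c : R) : v != 0 -> 0 < c ->
  (\int[mu]_(x in `[0%R, c]) (a * expR (- (v * x)) + b)%:E =
   (a * (v^-1 * (1 - expR (- (v * c)))) + b * c)%:E)%E.
Proof.
move=> v0 c0.
pose F x := a * (- v^-1 * expR (- (v * x))) + b * x.
have dF (x : R) : is_derive x 1 F (a * expR (- (v * x)) + b).
  rewrite /F; apply: is_derive_eq.
  (* The derivative found by instance inference, restated with products in place of scalings so that
     [field] applies. *)
  rewrite -[LHS]/(a * (- v^-1 * (expR (- (v * x)) * - (v * 1))) + b * 1).
  by field.
have cE : continuous (fun x : R => expR (- (v * x))).
  move=> x; apply: continuous_comp; last exact: continuous_expR.
  by apply: cvgN; apply: cvgMr; exact: cvg_id.
have cF : continuous F.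
  move=> x; apply: cvgD; last by apply: cvgMr; exact: cvg_id.
  by do 2!apply: cvgMr; exact: cE.
rewrite (@continuous_FTC2 _ _ F) //.
- by rewrite /F -EFinB !mulr0 oppr0 expR0; congr EFin; ring.
- apply: continuous_subspaceT => x.
  by apply: cvgD; [apply: cvgMr; exact: cE|exact: cvg_cst].
- split=> [x _||]; first by case: (dF x).
  + by apply: cvg_at_right_filter; exact: cF.
  + by apply: cvg_at_left_filter; exact: cF.
- by move=> x _; rewrite derive1E; case: (dF x).
Qed.

Lemma measurable_expRN_height (v : R) n :
  measurable_fun [set: n.-tuple RT] (fun x => expR (- (v * height x))).
Proof.
apply: (@measurableT_comp _ _ _ _ _ _ (@expR R)) => //; apply: measurable_funN.
by apply: measurable_funM => //; exact: measurable_height.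
Qed.

(** The weight depends on the height only, so it is constant on each slice; the slices are
    reassembled by Tonelli and a measure-preserving shear. *)
Lemma laplaceE n (t : arbor n.+1) (v : R) :
  (laplace t v = \int[lebesgue_tuple R n.+1]_x
    (\1_(polytope t) x * expR (- (v * height x)))%:E)%E.
Proof.
set g := fun x => _.
have mg : measurable_fun [set: n.+1.-tuple RT] g.
  apply/measurable_EFinP; apply: measurable_funM.
    by apply: measurable_indic; exact: measurable_polytope.
  exact: measurable_expRN_height.
have g0 x : (0 <= g x)%E by rewrite lee_fin mulr_ge0 ?expR_ge0.
have mgc : measurable_fun [set: RT * n.-tuple RT] (g \o @tuple_cons R n).
  by apply: (measurableT_comp mg); exact: measurable_tuple_cons.
(* After this shear the first coordinate of a pair is the height of the resulting point. *)
pose sh (p : RT * n.-tuple RT) : RT * n.-tuple RT := (p.1 - height p.2, p.2).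
have msh : measurable_fun [set: _] sh.
  apply: measurable_fun_pair => //=.
  apply: measurable_funB => //=.
  by apply: (measurableT_comp (@measurable_height R n)).
have mgsh : measurable_fun [set: RT * n.-tuple RT] (g \o @tuple_cons R n \o sh).
  exact: (measurableT_comp mgc msh).
rewrite integral_lebesgue_tupleS //.
rewrite (@fubini_tonelli _ _ _ _ _ _ _ (g \o @tuple_cons R n)) //;
  last by move=> ?; exact: g0.
(* With y outermost, the shear is a translation of the inner variable by the constant
   [- height y]. *)
transitivity (\int[lebesgue_tuple R n]_y
    \int[mu]_x (g \o @tuple_cons R n \o sh) (x, y))%E; last first.
  apply: eq_integral => y _.
  apply: (@ge0_integral_shift (- height y) (fun x => g (tuple_cons (x, y)))).
    by apply: (measurableT_comp mgc); exact: measurable_pair2.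
  by move=> x; exact: g0.
rewrite -(@fubini_tonelli _ _ _ _ _ _ _ (g \o @tuple_cons R n \o sh)) //;
  last by move=> ?; exact: g0.
rewrite /laplace integral_mkcond; apply: eq_integral => h _.
have E : (\int[lebesgue_tuple R n]_y (g \o @tuple_cons R n \o sh) (h, y) =
  (expR (- (v * h)))%:E * volume_function t h)%E.
  pose S := [set y : n.-tuple RT | polytope t (tuple_cons (h - height y, y))].
  have mS : measurable S.
    have mf := measurableT_comp
      (measurableT_comp (@measurable_tuple_cons R n) msh) (@measurable_pair1 _ _ _ _ h).
    by rewrite -[S]setTI; apply: mf => //; exact: measurable_polytope.
  transitivity (\int[lebesgue_tuple R n]_y
     ((\1_S y)%:E * (expR (- (v * h)))%:E))%E.
    apply: eq_integral => y _.
    by rewrite /g /= height_cons subrK EFinM.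
  rewrite ge0_integralZr; first last.
  - by rewrite lee_fin expR_ge0.
  - by move=> y _; rewrite lee_fin.
  - by apply/measurable_EFinP; exact: measurable_indic.
  - exact: measurableT.
  - rewrite muleC; congr (_ * _)%E.
    by rewrite (integral_indic _ measurableT mS) setIT.
transitivity ((expR (- (v * h)))%:E * volume_function t h)%E; last exact/esym/E.
(* The Laplace integral runs over h >= 0 only; for h < 0 the slice is empty. *)
rewrite patchE; case: ifPn => // h0.
rewrite volume_function_out ?mule0 //; apply: contra h0.
by rewrite inE /= !in_itv /= andbT => /andP[].
Qed.

(* The bound on the height is a parameter because fixing the first coordinate x
   of a point lowers it to c - x. *)
Definition star_section m (c : R) : set (m.+1.-tuple RT) :=
  [set x | [/\ forall i, 0 <= tnth x i,
               forall i : 'I_m.+1, (i < m)%N -> tnth x i <= 1 &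
               height x <= c]].

Lemma measurable_star_section m c : measurable (star_section m c).
Proof.
have mpre (f : m.+1.-tuple RT -> RT) I : measurable_fun setT f ->
    measurable I -> measurable (f @^-1` I).
  by move=> mf mI; rewrite -[X in measurable X]setTI; exact: mf.
rewrite (_ : star_section m c =
    \bigcap_(i in [set: 'I_m.+1])
      ((fun x : m.+1.-tuple RT => tnth x i) @^-1` `[0, +oo[) `&`
    \bigcap_(i in [set i : 'I_m.+1 | (i < m)%N])
      ((fun x : m.+1.-tuple RT => tnth x i) @^-1` `]-oo, 1]) `&`
    (@height R m.+1) @^-1` `]-oo, c]).
  apply: measurableI; last by apply: mpre => //; exact: measurable_height.
  apply: measurableI; apply: fin_bigcap_measurable => [|i _];
    try exact: finite_finset; apply: mpre => //; exact: measurable_tnth.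
apply/seteqP; split=> x /=.
  case=> x0 x1 xc; split; last by rewrite in_itv.
  by split=> i im; rewrite /= in_itv /= ?x0 ?x1.
case=> -[x0 x1]; rewrite in_itv /= => xc; split=> // i.
  by have := x0 i I; rewrite /= in_itv /= andbT.
Qed.

Lemma star_section0P c (x : R) (y : 0.-tuple RT) :
  star_section 0 c (tuple_cons (x, y)) <-> 0 <= x <= c.
Proof.
rewrite /star_section /= height_cons /= /height big_ord0 addr0.
split=> [[x0 _ ->]|/andP[x0 xc]]; first by rewrite andbT; exact: (x0 ord0).
by split=> // i; rewrite ord1.
Qed.

(** The root is the last index, so coordinate 0 is a leaf, and removing it leaves a star with one
    leaf fewer. *)
Lemma star_sectionSP m c (x : R) (y : m.+1.-tuple RT) :
  star_section m.+1 c (tuple_cons (x, y)) <->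
  0 <= x <= 1 /\ star_section m (c - x) y.
Proof.
rewrite /star_section /= height_cons /= lerBrDl.
split=> [[x0 x1 xc]|[/andP[x0 x1] [y0 y1 yc]]].
  split; first by apply/andP; split; [exact: (x0 ord0)|exact: (x1 ord0)].
  split=> // i.
    by have := x0 (lift ord0 i); rewrite tnthS.
  by move=> im; have := x1 (lift ord0 i); rewrite tnthS; apply.
split=> // i; case: (unliftP ord0 i) => [j ->|->] //; rewrite tnthS //.
by move=> jm; apply: y1.
Qed.

(** Induction on the number of leaves, for all c, peeling off leaves until only the root is left. As
    each leaf uses at most 1 of the height, [m%:R < c] passes to m - 1 and c - x, and the root
    finally ranges over an interval of positive length. *)
Lemma integral_star_section (v : R) m c : 0 < v -> m%:R < c ->
  (\int[lebesgue_tuple R m.+1]_x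
     (\1_(star_section m c) x * expR (- (v * height x)))%:E =
   (v^-1 * ((v^-1 * (1 - expR (- v))) ^+ m - expR (- (v * c))))%:E)%E.
Proof.
move=> v0; pose g k d (x : k.+1.-tuple RT) :=
  (\1_(star_section k d) x * expR (- (v * height x)))%:E.
have g0 k d x : (0 <= g k d x)%E by rewrite lee_fin mulr_ge0 ?expR_ge0.
have mg k d : measurable_fun [set: k.+1.-tuple RT] (g k d).
  apply/measurable_EFinP; apply: measurable_funM.
    by apply: measurable_indic; exact: measurable_star_section.
  exact: measurable_expRN_height.
elim: m c => [|m IH] c mc; rewrite (integral_lebesgue_tupleS _ _ (mg _ c) (g0 _ c)).
  transitivity (\int[mu]_(x in `[0%R, c]) (1 * expR (- (v * x)) + 0)%:E)%E.
    rewrite [RHS]integral_mkcond; apply: eq_integral => x _.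
    (* The measure on R^0 is a Dirac mass, so the inner integral is evaluation at the empty
       tuple. *)
    transitivity (g 0%N c (tuple_cons (x, [tuple]))).
      rewrite integral_dirac //; last first.
        exact: (measurableT_comp (measurableT_comp (mg 0%N c)
          (@measurable_tuple_cons R 0)) (@measurable_pair1 _ _ _ _ x)).
      by rewrite diracE mem_set // mul1e.
    rewrite /g patchE indicE height_cons [height _]big_ord0 addr0 mul1r addr0.
    have -> : (tuple_cons (x, [tuple]) \in star_section 0 c) = (x \in `[0, c]).
      by apply/idP/idP; rewrite !inE /= ?in_itv /= => /star_section0P.
    by case: (x \in _); rewrite ?mul1r ?mul0r.
  by rewrite integral_expRN_affine ?gt_eqF // mul0r addr0 mul1r expr0.
set a := v^-1 * _ in IH *.
(* The weight e^(-vx) of the leaf turns the term e^(-v(c - x)) of the induction hypothesis into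
   e^(-vc), constant in x; integrating e^(-vx) over [0, 1] supplies the next factor [a]. *)
transitivity (\int[mu]_(x in `[0%R, 1%R])
    (v^-1 * a ^+ m * expR (- (v * x)) + - (v^-1 * expR (- (v * c))))%:E)%E.
  rewrite [RHS]integral_mkcond; apply: eq_integral => x _.
  rewrite patchE; case: ifPn => x01.
    transitivity (\int[lebesgue_tuple R m.+1]_y
        (g m (c - x)%R y * (expR (- (v * x)))%:E))%E.
      apply: eq_integral => y _; rewrite -EFinM; congr EFin.
      rewrite !indicE height_cons mulrDr opprD expRD mulrCA [RHS]mulrC.
      congr (_ * (_ * _)).
      have -> // : (tuple_cons (x, y) \in star_section m.+1 c) =
        (y \in star_section m (c - x)).
      apply/idP/idP => /set_mem h; apply/mem_set.
        by case/star_sectionSP: h.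
      by apply/star_sectionSP; split=> //; move: x01; rewrite inE /= in_itv.
    rewrite ge0_integralZr ?lee_fin ?expR_ge0 //; last exact: mg.
    rewrite inE /= in_itv /= in x01.
    rewrite IH; last first.
      by case/andP: x01 => _ x1; move: mc; rewrite -natr1; lra.
    rewrite -EFinM; congr EFin.
    have -> : - (v * c) = - (v * (c - x)) - v * x by ring.
    by rewrite expRD; ring.
  transitivity (0 : \bar R)%E => //; apply: integral0_eq => y _.
  rewrite /g indicE memNset ?mul0r // => /star_sectionSP[x01' _].
  by move/negP: x01; apply; rewrite inE /= in_itv.
rewrite integral_expRN_affine ?gt_eqF // !mulr1 -/a; congr EFin.
by rewrite exprS; ring.
Qed.

Lemma star_polytope m : @polytope R _ (star_arbor m) = star_section m m.+1%:R.
Proof. by apply/seteqP; split=> x /polytope_starP. Qed.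

Lemma is_laplace_poly_star m :
  is_laplace_poly R (star_arbor m)
    (Vvar * ((Vvar * (1 - Evar)) ^+ m - Evar ^+ m.+1)).
Proof.
move=> v v0; rewrite laplaceE star_polytope integral_star_section ?ltr_nat //.
congr EFin; rewrite /eval_EV /Vvar /Evar.
rewrite !(rmorphM, rmorphB, rmorphXn, rmorph1) /= ?(map_polyX, map_polyC) /=.
rewrite !hornerE /= map_polyX hornerX.
(* The bound c = m+1 turns e^(-vc) into E^(m+1). *)
by rewrite -mulNr expRM_natr.
Qed.

End integrals.

Theorem theorem3p3 (R : realType) :
  let s : fps {poly {poly rat}} := fpsX _ in
  let E := fpsC Evar in
  let V := fpsC Vvar in
  Fps (fun n => if n is m.+1 then laplace_poly R (star_arbor m) else 0) =
  V * (s / (E * V * s - V * s + 1) + E * s / (E * s - 1)).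
Proof.
by apply: series_star => m; apply: laplace_polyE; exact: is_laplace_poly_star.
Qed.
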